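(* Let $n\ge 7$ and let $\Gamma(G)$ be a signed graph whose underlying graph $G$ belongs to $B_n^+$. Then $\eta(\Gamma(G))\le n-6$.
   Context: A signed graph $\Gamma(G)=(G,\sigma)$ consists of a simple graph $G$ and a map $\sigma:E(G)\to\{+,-\}$; its adjacency matrix has entry $\sigma(v_iv_j)$ for edges and $0$ otherwise, and $\eta(\Gamma(G))$ is the multiplicity of $0$ as an eigenvalue. A bicyclic graph is a connected simple graph with $|E|=|V|+1$. The graph $\infty(p,q,l)$ ($p,q\ge3$, $l\ge1$) is obtained from vertex-disjoint cycles $C_p$, $C_q$ by joining a vertex of $C_p$ to a vertex of $C_q$ by a path on $l$ vertices (identifying the two vertices when $l=1$). $B_n^+$ is the set of bicyclic graphs on $n$ vertices obtained from some $\infty(p,q,l)$ with $l>1$ by (possibly) attaching trees to some of its vertices. *)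

(* Defs.v *)
From mathcomp Require Import all_boot all_order all_algebra.

Set Implicit Arguments.
Unset Strict Implicit.
Unset Printing Implicit Defensive.

Import GRing.Theory.
Local Open Scope nat_scope.

Definition simple_graph (V : finType) (e : rel V) : Prop :=
  symmetric e /\ irreflexive e.

Definition edges (V : finType) (e : rel V) : {set {set V}} :=
  [set [set x; y] | x in V, y in e x].

Definition connected_graph (V : finType) (e : rel V) : Prop :=
  forall x y : V, connect e x y.

Definition bicyclic (V : finType) (e : rel V) : Prop :=
  [/\ simple_graph e, connected_graph e & #|edges e| = #|V|.+1].

Definition induced_on (V : finType) (e : rel V) (S : {set V}) : rel V :=
  [rel x y | [&& x \in S, y \in S & e x y]].

(* For a symmetric irreflexive relation the only [ucycle]s that are not cycles
   of the graph are the empty one and the back-and-forth walks along an edge,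
   of size 2. *)
Definition acyclic (V : finType) (e : rel V) : Prop :=
  forall c : seq V, ucycle e c -> size c <= 2.

Definition induces_tree (V : finType) (e : rel V) (S : {set V}) : Prop :=
  [/\ S != set0,
      {in S &, forall x y, connect (induced_on e S) x y}
    & acyclic (induced_on e S)].

(* Oriented edges (from the smaller to the larger end) of the path
   a, a+1, ..., b and of the cycle a, a+1, ..., b, a. *)
Definition path_arc (a b : nat) : rel nat :=
  [rel i j | [&& a <= i, j <= b & j == i.+1]].

Definition cycle_arc (a b : nat) : rel nat :=
  [rel i j | path_arc a b i j || (i == a) && (j == b)].

(* oo(p,q,l) on the p + q + l - 2 vertices 0, 1, ...:
   C_p occupies 0 .. p-1, the path on l vertices occupies p-1 .. p+l-2 and
   C_q occupies p+l-2 .. p+q+l-3, so that the end vertices of the path lie on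
   the two cycles; for l = 1 the cycles share the vertex p-1. *)
Definition infty_arc (p q l : nat) : rel nat :=
  [rel i j | [|| cycle_arc 0 (p - 1) i j,
                 path_arc (p - 1) (p + l - 2) i j
               | cycle_arc (p + l - 2) (p + q + l - 3) i j]].

Definition infty_graph (p q l : nat) : rel 'I_(p + q + l - 2) :=
  fun i j => infty_arc p q l i j || infty_arc p q l j i.

(* G = (V, e) arises from H = (U, h) by attaching trees: [core] embeds H in G,
   and the vertices [v] with [root v = u] span the tree attached at [u], which
   meets H exactly in [core u] (it is the single vertex [core u] if nothing is
   attached there).  Several trees attached at [u] are merged into one. *)
Definition trees_attached (U V : finType) (h : rel U) (e : rel V) : Prop :=
  exists (core : U -> V) (root : V -> U),
    [/\ cancel core root,
        forall u : U, induces_tree e [set v | root v == u]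
      & forall x y : V, root x != root y ->
          e x y = [&& x == core (root x), y == core (root y)
                    & h (root x) (root y)]].

Definition Bplus (n : nat) (e : rel 'I_n) : Prop :=
  bicyclic e /\
  exists p q l : nat,
    [/\ 3 <= p, 3 <= q, 1 < l & trees_attached (@infty_graph p q l) e].

(* The sign of the edge {i,j} is - when [sigma [set i; j]] is true, and + when
   it is false; the values of [sigma] outside [edges e] are not used. *)
Definition signed_adjacency (R : nzRingType) (n : nat) (e : rel 'I_n)
    (sigma : {set 'I_n} -> bool) : 'M[R]_n :=
  (\matrix_(i < n, j < n)
     if e i j then (-1) ^+ sigma [set i; j] else 0)%R.

Definition nullity (R : fieldType) (n : nat) (e : rel 'I_n)
    (sigma : {set 'I_n} -> bool) : nat :=
  mup 0%R (char_poly (signed_adjacency R e sigma)).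

(* Main.v *)
(* The attached trees play no role: oo(p,q,l) is an induced subgraph, and inside
   it the last three vertices of C_p, counted up to the attaching vertex, and
   the next three vertices along the path and C_q induce a path on six vertices
   plus at most two chords, closing its first three vertices (if p = 3) or its
   last three (if l = 2 and q = 3) into a triangle. Such a signed graph is
   nonsingular, since its determinant is an odd integer, so the adjacency matrix
   has rank at least 6. For a real symmetric matrix the algebraic multiplicity
   of 0 is the corank. *)
Require Import Defs.
From mathcomp Require Import all_boot all_order all_algebra.
From mathcomp Require Import ring lra zify.

Set Implicit Arguments.
Unset Strict Implicit.
Unset Printing Implicit Defensive.

Import Order.TTheory GRing.Theory Num.Theory.

Local Open Scope ring_scope.

(* Both sides are ['X^r] times the determinant of [[X, C], [B, 1]]. *)
Lemma char_poly_mulmxC (R : comNzRingType) (n r : nat)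
    (C : 'M[R]_(n, r)) (B : 'M[R]_(r, n)) :
  'X^r * char_poly (C *m B) = 'X^n * char_poly (B *m C).
Proof.
rewrite /char_poly /char_poly_mx !map_mxM /=.
set c := map_mx _ C; set b := map_mx _ B.
set N := block_mx ('X%:M) c b 1%:M.
have detN : \det N = \det ('X%:M - c *m b).
  have := det_mulmx N (block_mx 1%:M 0 (- b) 1%:M).
  rewrite mulmx_block !mulmx1 !mulmx0 !mul1mx mulmxN !add0r subrr.
  by rewrite det_ublock det_lblock !det_scalar !expr1n !mulr1 => <-.
have := det_mulmx (block_mx 1%:M 0 (- b) 'X%:M) N.
rewrite mulmx_block !mul0mx !mul1mx !addr0 mulmx1 mulNmx.
rewrite mul_mx_scalar mul_scalar_mx addNr mulNmx [- _ + _]addrC.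
by rewrite det_ublock det_lblock !det_scalar expr1n mul1r detN => <-.
Qed.

Lemma mulmx_tr_eq0 (R : realDomainType) (n : nat) (w : 'rV[R]_n) :
  w *m w^T = 0 -> w = 0.
Proof.
move/matrixP/(_ 0 0); rewrite !mxE => sq0; apply/rowP => j; rewrite mxE.
have sq_ge0 i : true -> 0 <= w 0 i * w^T i 0 by rewrite mxE -expr2 sqr_ge0.
have /eqP := psumr_eq0P sq_ge0 sq0 (isT : xpredT j).
by rewrite mxE -expr2 sqrf_eq0 => /eqP.
Qed.

(** Factor [A = C *m B] through its rank r. By [char_poly_mulmxC], 0 has multiplicity n - r as soon
    as [B *m C] is nonsingular. If [v *m B *m C = 0], then w = [v *m B] lies in the row space of [A]
    and is killed by [A]; by symmetry w is orthogonal to itself, hence zero. *)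
Lemma mup0_char_poly_sym (R : realFieldType) (n : nat) (A : 'M[R]_n) :
  A^T = A -> mup 0 (char_poly A) = (n - \rank A)%N.
Proof.
move=> symA; set C := col_base A; set B := row_base A.
have CB : C *m B = A by exact: mulmx_base.
have BC_free : row_free (B *m C).
  apply: inj_row_free => v vBC0.
  have [u uE] : exists u, v *m B = u *m A.
    by apply/submxP/(submx_trans (submxMl _ _)); rewrite eq_row_base.
  have vBA0 : v *m B *m A = 0.
    by rewrite -[X in v *m B *m X]CB mulmxA -(mulmxA v) vBC0 mul0mx.
  have : v *m B = 0.
    by apply: mulmx_tr_eq0; rewrite {2}uE trmx_mul symA mulmxA vBA0 mul0mx.
  by move/eqP; rewrite mulmx_free_eq0 ?row_base_free // => /eqP.
have BC_nroot : ~~ root (char_poly (B *m C)) 0.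
  rewrite rootE horner_coef0 char_poly_det mulf_eq0 signr_eq0 /=.
  by rewrite -unitfE -unitmxE -row_free_unit.
have mupX k : mup 0 ('X^k : {poly R}) = k.
  by rewrite -['X]subr0 -[0 in X in mup _ X]polyC0 mup_XsubCX eqxx.
have /(congr1 (mup 0)) := char_poly_mulmxC C B.
rewrite CB (mupMl _ BC_nroot) mupM ?monic_neq0 ?monicXn ?char_poly_monic // !mupX.
by move=> rank_mup; rewrite -[X in (X - _)%N]rank_mup addKn.
Qed.

Lemma mxrank_mxsub_leq (F : fieldType) (m n p q : nat)
    (f : 'I_p -> 'I_m) (g : 'I_q -> 'I_n) (A : 'M[F]_(m, n)) :
  (\rank (mxsub f g A) <= \rank A)%N.
Proof.
rewrite mxsubrc (leq_trans (mxrankS (rowsub_sub _ _))) //.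
by rewrite -mxrank_tr trmx_mxsub -[leqRHS]mxrank_tr mxrankS // rowsub_sub.
Qed.

(* The equations of the kernel of the path 0, ..., 5 with edge weights a_i and
   chords 02, 35 of weights c, d; the determinant is 4 a0 a1 c a3 a4 d - 1. *)
Lemma two_triangles_kernel (R : realFieldType)
    (a0 a1 a2 a3 a4 c d v0 v1 v2 v3 v4 v5 : R) :
    a0 ^+ 2 = 1 -> a1 ^+ 2 = 1 -> a2 ^+ 2 = 1 -> a3 ^+ 2 = 1 -> a4 ^+ 2 = 1 ->
    c = 0 \/ c ^+ 2 = 1 -> d = 0 \/ d ^+ 2 = 1 ->
    v1 * a0 + v2 * c = 0 -> v0 * a0 + v2 * a1 = 0 ->
    v0 * c + v1 * a1 + v3 * a2 = 0 -> v2 * a2 + v4 * a3 + v5 * d = 0 ->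
    v3 * a3 + v5 * a4 = 0 -> v3 * d + v4 * a4 = 0 ->
  [/\ v0 = 0, v1 = 0 & v2 = 0] /\ [/\ v3 = 0, v4 = 0 & v5 = 0].
Proof.
move=> s0 s1 s2 s3 s4 cE dE e0 e1 e2 e3 e4 e5.
(* A sign is its own inverse, so each equation yields one unknown: [v0] and [v1] from [v2], then
   [v3], then [v4] and [v5], and finally [v2] again. *)
have solve a x y : a ^+ 2 = 1 -> x * a + y = 0 -> x = - (y * a) :> R.
  by move=> sqa /addr0_eq <-; rewrite mulNr opprK -mulrA -expr2 sqa mulr1.
have v1E := solve _ _ _ s0 e0; have v0E := solve _ _ _ s0 e1.
rewrite addrC in e4; have v5E := solve _ _ _ s4 e4.
rewrite addrC in e5; have v4E := solve _ _ _ s4 e5.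
rewrite addrC in e2; have v3E := solve _ _ _ s2 e2.
rewrite -addrA in e3; have v2E := solve _ _ _ s2 e3.
pose t := a0 * a1 * c * (a3 * a4 * d).
have v2_fix : v2 * (1 - 4 * t) = 0.
  (* The substitution uses the middle edge twice; [a2 ^+ 2] is put into [t] beforehand because
     [ring] does not know [s2]. *)
  rewrite -[t]mulr1 -[in t * 1]s2 mulrBr mulr1 {1}v2E v4E v5E v3E v0E v1E /t.
  by ring.
(* [t] is 0, 1 or -1, so this is 1, -3 or 5, nonzero in characteristic 0. *)
have t_neq : 1 - 4 * t != 0.
  have : t ^+ 2 = 0 \/ t ^+ 2 = 1.
    rewrite /t !exprMn s0 s1 s3 s4 !mul1r.
    case: cE dE => [-> _|->]; first by left; rewrite expr0n mul0r.
    by case=> ->; [left | right]; rewrite mul1r ?expr0n.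
  by move=> t2; apply/eqP => t1; case: t2; nra.
have v2_0 : v2 = 0.
  by move/eqP: v2_fix; rewrite mulf_eq0 (negPf t_neq) orbF => /eqP.
have v1_0 : v1 = 0 by rewrite v1E v2_0 !mul0r oppr0.
have v0_0 : v0 = 0 by rewrite v0E v2_0 !mul0r oppr0.
have v3_0 : v3 = 0 by rewrite v3E v0_0 v1_0 !mul0r addr0 mul0r oppr0.
by rewrite v4E v5E v3_0 !mul0r oppr0.
Qed.

(** Leaving the entries at (0, 2) and (3, 5) either zero or a sign treats all four combinations of
    chords at once. *)
Lemma two_triangles_row_free (R : realFieldType) (M : 'M[R]_6) :
    M^T = M ->
    (forall i j, M i j = 0 \/ M i j ^+ 2 = 1) ->
    (forall i j : 'I_6, j = i.+1 :> nat -> M i j != 0) ->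
    (forall i j : 'I_6, (i <= j)%N -> j != i.+1 :> nat ->
      ((i : nat, j : nat) \notin [:: (0, 2); (3, 5)])%N -> M i j = 0) ->
  row_free M.
Proof.
move=> symM sqM pathM zeroM; apply: inj_row_free => v vM0.
have sym i j : M i j = M j i by rewrite -{1}symM mxE.
pose o k : 'I_6 := inord k.
have oE (k : nat) (i : 'I_6) : k = i -> i = o k.
  by move=> ->; rewrite /o inord_val.
have vMj j : \sum_i v 0 i * M i j = 0.
  by move/matrixP: vM0 => /(_ 0 j); rewrite !mxE.
have sum6 (F : 'I_6 -> R) :
    \sum_i F i = F (o 0) + F (o 1) + F (o 2) + F (o 3) + F (o 4) + F (o 5).
  rewrite !big_ord_recl big_ord0 addr0 !addrA.
  by do 5?congr (_ + _); congr F; apply: oE.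
have sq k : (k < 5)%N -> M (o k) (o k.+1) ^+ 2 = 1.
  move=> lt5; case: (sqM (o k) (o k.+1)) => // M0; move: M0 => /eqP.
  by rewrite (negPf (pathM _ _ _)) // !inordK //; lia.
have z i j : (i <= j < 6)%N -> j != i.+1 ->
    ((i, j) \notin [:: (0, 2); (3, 5)])%N -> M (o i) (o j) = 0.
  by move=> /andP[lij lj] *; apply: zeroM; rewrite ?inordK //; lia.
have := (vMj (o 0), vMj (o 1), vMj (o 2), vMj (o 3), vMj (o 4), vMj (o 5)).
rewrite !sum6.
(* Entries below the diagonal are reflected above it, and those off the path and the chords vanish;
   the six equations of [two_triangles_kernel] remain. *)
rewrite (sym (o 1) (o 0)) (sym (o 2) (o 0)) (sym (o 2) (o 1)).
rewrite (sym (o 3) (o 0)) (sym (o 3) (o 1)) (sym (o 3) (o 2)).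
rewrite (sym (o 4) (o 0)) (sym (o 4) (o 1)) (sym (o 4) (o 2)) (sym (o 4) (o 3)).
rewrite (sym (o 5) (o 0)) (sym (o 5) (o 1)) (sym (o 5) (o 2)) (sym (o 5) (o 3)).
rewrite (sym (o 5) (o 4)) (z 0 0)%N // (z 0 3)%N // (z 0 4)%N // (z 0 5)%N //.
rewrite (z 1 1)%N // (z 1 3)%N // (z 1 4)%N // (z 1 5)%N //.
rewrite (z 2 2)%N // (z 2 4)%N // (z 2 5)%N //.
rewrite (z 3 3)%N // (z 4 4)%N // (z 5 5)%N //.
rewrite !mulr0 !addr0 !add0r.
have := (sq 0%N isT, sq 1%N isT, sq 2%N isT, sq 3%N isT, sq 4%N isT).
have := (sqM (o 0) (o 2), sqM (o 3) (o 5)).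
move=> [cE dE] [[[[s0 s1] s2] s3] s4] [[[[[e0 e1] e2] e3] e4] e5].
have [[v0 v1 v2] [v3 v4 v5]] := two_triangles_kernel s0 s1 s2 s3 s4 cE dE
  e0 e1 e2 e3 e4 e5.
apply/rowP => j; rewrite mxE.
have : all (fun k => v 0 (o k) == 0) (iota 0 6).
  by rewrite /= v0 v1 v2 v3 v4 v5 !eqxx.
by move/allP/(_ (j : nat)); rewrite mem_iota ltn_ord -(oE _ j erefl) => /(_ isT)/eqP.
Qed.

Local Open Scope nat_scope.

(** The offset [p - 3] puts index 2 on the attaching vertex of C_p. The edge closing C_p starts at
    vertex 0, which is in range only if [p = 3]; the one closing C_q joins indices l + 1 and l + q,
    both below 6 only if [l = 2] and [q = 3]. *)
Lemma infty_segmentE (p q l i j : nat) :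
  3 <= p -> 3 <= q -> 1 < l -> i <= j < 6 ->
  let h := infty_arc p q l in
  h (p - 3 + i) (p - 3 + j) || h (p - 3 + j) (p - 3 + i) =
  [|| j == i.+1, [&& p == 3, i == 0 & j == 2]
    | [&& l == 2, q == 3, i == 3 & j == 5]].
Proof.
move=> p3 q3 l2 /andP[ij j6]; rewrite /= /infty_arc /cycle_arc /path_arc /=.
have -> : (p - 3 + j == (p - 3 + i).+1) = (j == i.+1) by lia.
have -> : (p - 3 + i == (p - 3 + j).+1) = false by lia.
have -> : (p - 3 + i == 0) && (p - 3 + j == p - 1) =
    [&& p == 3, i == 0 & j == 2] by lia.
have -> : (p - 3 + j == 0) && (p - 3 + i == p - 1) = false by lia.
have -> : (p - 3 + i == p + l - 2) && (p - 3 + j == p + q + l - 3) =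
    [&& l == 2, q == 3, i == 3 & j == 5] by lia.
have -> : (p - 3 + j == p + l - 2) && (p - 3 + i == p + q + l - 3) = false.
  by lia.
rewrite !andbF !orbF.
have [jE|] := eqVneq j i.+1; last by rewrite !andbF !orFb.
rewrite !andbT !orTb.
(* The three ranges share their end vertices, so a consecutive pair always fits in one of them. *)
have [-> // | [/andP[-> ->] | /andP[-> ->]]] : (p - 3 + j <= p - 1) \/
    (p - 1 <= p - 3 + i) && (p - 3 + j <= p + l - 2) \/
    (p + l - 2 <= p - 3 + i) && (p - 3 + j <= p + q + l - 3) by lia.
  by rewrite !orbT.
by rewrite !orbT.
Qed.

Lemma trees_attached_coreE (U V : finType) (h : rel U) (e : rel V)
    (core : U -> V) (root : V -> U) :
    cancel core root -> irreflexive h -> irreflexive e ->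
    (forall x y : V, root x != root y ->
       e x y = [&& x == core (root x), y == core (root y)
                 & h (root x) (root y)]) ->
  forall u w : U, e (core u) (core w) = h u w.
Proof.
move=> coreK hI eI eE u w; have [-> | neq_uw] := eqVneq u w.
  by rewrite hI eI.
by rewrite eE !coreK // !eqxx.
Qed.

Theorem theorem5p3 (R : realFieldType) (n : nat) (hn : 7 <= n)
  (e : rel 'I_n) (sigma : {set 'I_n} -> bool) (he : Bplus e) :
  nullity R e sigma <= n - 6.
Proof.
have [[[symE irrE] _ _] [p [q [l [p3 q3 l2]]]]] := he.
case=> core [root [coreK _ eE]].
have irrH : irreflexive (@infty_graph p q l).
  move=> u; rewrite /infty_graph orbb /infty_arc /cycle_arc /path_arc /=.
  by lia.
have coreE := trees_attached_coreE coreK irrH irrE eE.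
(* Six vertices fit because [q + l] is at least 5. *)
have seg_lt (i : 'I_6) : p - 3 + i < p + q + l - 2 by have := ltn_ord i; lia.
pose seg (i : 'I_6) := core (Ordinal (seg_lt i)).
have segE (i j : 'I_6) : i <= j -> e (seg i) (seg j) =
    [|| j == i.+1 :> nat, [&& p == 3, i == 0 :> nat & j == 2 :> nat]
      | [&& l == 2, q == 3, i == 3 :> nat & j == 5 :> nat]].
  by move=> ij; rewrite coreE /infty_graph /= infty_segmentE // ij ltn_ord.
set A := signed_adjacency R e sigma.
have symA : (A^T = A)%R.
  by apply/matrixP => i j; rewrite !mxE symE setUC.
rewrite /nullity -/A mup0_char_poly_sym // leq_sub2l //.
(* It remains to bound the rank of [A] below by 6, through the submatrix on the segment. *)
apply: leq_trans (mxrank_mxsub_leq seg seg A).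
suff /eqP -> : row_free (mxsub seg seg A) by [].
apply: two_triangles_row_free => [|i j|i j ij|i j ij].
- by rewrite trmx_mxsub symA.
- rewrite !mxE; case: ifP => _; last by left.
  by right; rewrite sqrr_sign.
- by rewrite !mxE segE ij ?leqnSn // eqxx signr_eq0.
- move=> /negPf njS; rewrite !inE !xpair_eqE !mxE segE // njS /=.
  by case: ifP => //; lia.
Qed.
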